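(* Let $0\le d_1\le d_2$ be integers. The bigraded Hilbert series of the ideal $$J(d_1,d_2)=(a,b)^{d_1}\cap(c,d)^{d_2}\cap(a-c,b-d)^{d_1}\subseteq\mathbb{C}[a,b,c,d]$$ is equal to $$\frac{q^{2d_1+d_2}}{(1-q)^2(1-t/q)(1-t/q^2)}+\frac{t^{2d_1+d_2}}{(1-t)^2(1-q/t)(1-q/t^2)}$$ $$+\frac{q^{d_1}t^{d_2}(1+t)}{(1-q)(1-t)(1-q/t)(1-t^2/q)}+\frac{q^{d_2}t^{d_1}(1+q)}{(1-t)(1-q)(1-t/q)(1-q^2/t)}.$$
   Context: The ring $\mathbb{C}[a,b,c,d]$ is bigraded with $a,c$ of bidegree $q$ and $b,d$ of bidegree $t$; the Hilbert series of a bigraded subspace $V=\bigoplus V_{m,n}$ is $\sum\dim(V_{m,n})q^mt^n$. The equality means that the Hilbert series is the power series expansion of the displayed rational function (the sum of the four terms). *)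

(* Defs.v *)
From HB Require Import structures.
From mathcomp Require Import all_boot all_order all_algebra.
From mathcomp Require Import reals complex mpoly.

Set Implicit Arguments.
Unset Strict Implicit.
Unset Printing Implicit Defensive.

Import GRing.Theory.
Local Open Scope ring_scope.

Section Ideals.
Variable A : comNzRingType.
Implicit Types (S I : A -> Prop) (f : A).

Definition ideal_gen S f : Prop :=
  exists (k : nat) (r g : 'I_k -> A),
    (forall i, S (g i)) /\ f = \sum_i r i * g i.

Definition ideal_gen2 (x y : A) : A -> Prop :=
  ideal_gen (fun f => f = x \/ f = y).

(* For n = 0 the only generator is the empty product 1, so that I^0 = A. *)
Definition ideal_pow I (n : nat) : A -> Prop :=
  ideal_gen (fun f => exists g : 'I_n -> A,
    (forall i, I (g i)) /\ f = \prod_i g i).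

End Ideals.

Section Bigraded.
Variable K : fieldType.
Implicit Types (V : {mpoly K[4]} -> Prop) (f : {mpoly K[4]}).

Definition va : 'I_4 := @Ordinal 4 0 isT.
Definition vb : 'I_4 := @Ordinal 4 1 isT.
Definition vc : 'I_4 := @Ordinal 4 2 isT.
Definition vd : 'I_4 := @Ordinal 4 3 isT.

(* (exponent of q, exponent of t): a, c have bidegree q and b, d bidegree t. *)
Definition bideg (m : 'X_{1..4}) : nat * nat :=
  ((m va + m vc)%N, (m vb + m vd)%N).

Definition bicomp (i j : nat) f : {mpoly K[4]} :=
  \sum_(m <- msupp f | bideg m == (i, j)) f@_m *: 'X_[m].

Definition bihomog (i j : nat) f : Prop :=
  forall m, m \in msupp f -> bideg m = (i, j).

Definition bigraded V : Prop :=
  forall f, V f -> forall i j, V (bicomp i j f).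

Definition piece V (i j : nat) f : Prop := V f /\ bihomog i j f.

(* Meant for linear subspaces V. *)
Definition has_dim V (k : nat) : Prop :=
  exists e : 'I_k -> {mpoly K[4]},
    [/\ forall i, V (e i),
        forall c : 'I_k -> K, \sum_i c i *: e i = 0 -> forall i, c i = 0
      & forall f, V f -> exists c : 'I_k -> K, f = \sum_i c i *: e i].

(* h i j is the coefficient of q^i t^j. *)
Definition is_hilbert_series V (h : nat -> nat -> nat) : Prop :=
  bigraded V /\ forall i j, has_dim (piece V i j) (h i j).

Definition idealJ (d1 d2 : nat) f : Prop :=
  let a := 'X_va : {mpoly K[4]} in let b := 'X_vb : {mpoly K[4]} in
  let c := 'X_vc : {mpoly K[4]} in let d := 'X_vd : {mpoly K[4]} in
  [/\ ideal_pow (ideal_gen2 a b) d1 f,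
      ideal_pow (ideal_gen2 c d) d2 f
    & ideal_pow (ideal_gen2 (a - c) (b - d)) d1 f].

End Bigraded.

Local Notation "x %:F" := (@FracField.tofrac _ x).

Definition ratfun2 : fieldType := {fraction {mpoly rat[2]}}.

Definition qvar : ratfun2 := ('X_(@Ordinal 2 0 isT) : {mpoly rat[2]})%:F.
Definition tvar : ratfun2 := ('X_(@Ordinal 2 1 isT) : {mpoly rat[2]})%:F.

Definition mon2 (i j : nat) : 'X_{1..2} := [multinom [tuple i; j]].

(* The rational function F is regular at the origin, F = N / D with
   D(0, 0) != 0, and its power series expansion there is the series
   \sum h i j q^i t^j, i.e., D h = N in Q[[q, t]]. *)
Definition is_expansion (F : ratfun2) (h : nat -> nat -> rat) : Prop :=
  exists N D : {mpoly rat[2]},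
    [/\ D@_(mon2 0 0) != 0, F = N%:F / D%:F
      & forall m n : nat,
          \sum_(i < m.+1) \sum_(j < n.+1) D@_(mon2 i j) * h (m - i)%N (n - j)%N
          = N@_(mon2 m n)].

Definition hilbert_fun (d1 d2 : nat) : ratfun2 :=
  let q := qvar in let t := tvar in
    q ^+ (2 * d1 + d2)%N / ((1 - q) ^+ 2 * (1 - t / q) * (1 - t / q ^+ 2))
  + t ^+ (2 * d1 + d2)%N / ((1 - t) ^+ 2 * (1 - q / t) * (1 - q / t ^+ 2))
  + q ^+ d1 * t ^+ d2 * (1 + t)
      / ((1 - q) * (1 - t) * (1 - q / t) * (1 - t ^+ 2 / q))
  + q ^+ d2 * t ^+ d1 * (1 + q)
      / ((1 - t) * (1 - q) * (1 - t / q) * (1 - q ^+ 2 / t)).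

(* Main.v *)
Require Import Defs.
From HB Require Import structures.
From mathcomp Require Import all_boot all_order all_algebra.
From mathcomp Require Import reals complex mpoly.
From mathcomp Require Import ring zify.
Import GRing.Theory.
Local Open Scope ring_scope.

(** The polynomial ring is the coordinate ring of 2 x 2 matrices with rows
    (a, b) and (c, d), and J = J(d1, d2) consists of the polynomials that
    vanish to order at least d1, d2, d1 along the three linear subspaces where
    the row (a, b), the row (c, d), or the difference of the two rows is zero.
    The determinant Delta = ad - bc vanishes to order exactly 1 along each of
    them.

    Restrict a polynomial of bidegree (i, j) to the matrices with equal columns
    and set the second row to 1: this is the substitution a, b := X and
    c, d := 1.  Its kernel is the ideal of Delta, because modulo Delta every
    polynomial of bidegree (i, j) is a combination of standard monomials, which
    have distinct images 1, X, ..., X^(i+j) ([std_form], [restr_ker]).  On J the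
    image lies in X^d1 (X-1)^d1 K[X] and in degree at most i + j - d2, and it is
    all of that space: each X^(d1+l) (X-1)^d1 is the image of a product of i
    linear forms taken among a, a-c, c and j among b, b-d, d ([exists_lift]).
    Since Delta g is in J(d1, d2) if and only if g is in J(d1-1, d2-1), with
    truncated subtraction ([idealJ_Delta]), the piece dimensions satisfy

      h(d1, d2; i, j) = max(0, i + j + 1 - 2 d1 - d2)
                        + h(d1 - 1, d2 - 1; i - 1, j - 1),

    the last term being 0 when i = 0 or j = 0 ([has_dim_piece]).

    The order of vanishing is made algebraic by letting a parameter z scale the
    direction transverse to the subspace: f lies in the d-th power of the ideal
    if and only if z^d divides the resulting polynomial in z ([order_geP]); one
    direction holds because the coefficient of z^k lies in the k-th power, i.e.,
    the polynomial lies in the Rees algebra, and z = 1 gives f back.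

    On the side of series the recursion reads H(d1, d2) = G(2 d1 + d2)
    + q t H(d1 - 1, d2 - 1) with G(N) the sum of max(0, i + j + 1 - N) q^i t^j.
    The series G(N) is rational, by induction on N ([is_expansion_excess]), and
    the sum of four terms satisfies the same recursion by an identity of
    rational functions ([four_terms_shift], [four_terms_shift1]). *)

Set Implicit Arguments.
Unset Strict Implicit.
Unset Printing Implicit Defensive.

(** * The rational functions *)

Section RationalFunctions.
Variables (F : fieldType) (q t : F).
Hypotheses (q0 : q != 0) (t0 : t != 0) (q1 : 1 - q != 0) (t1 : 1 - t != 0).
Hypotheses (qt : q - t != 0) (q2t : q ^+ 2 - t != 0) (t2q : t ^+ 2 - q != 0).

(** The displayed sum of four terms, where A, B, C, E stand for the powers
    q^d1, q^d2, t^d1, t^d2; with the powers abstracted, the recursion in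
    (d1, d2) becomes an identity of rational functions in six variables. *)
Definition four_terms (A B C E : F) : F :=
    A ^+ 2 * B / ((1 - q) ^+ 2 * (1 - t / q) * (1 - t / q ^+ 2))
  + C ^+ 2 * E / ((1 - t) ^+ 2 * (1 - q / t) * (1 - q / t ^+ 2))
  + A * E * (1 + t) / ((1 - q) * (1 - t) * (1 - q / t) * (1 - t ^+ 2 / q))
  + B * C * (1 + q) / ((1 - t) * (1 - q) * (1 - t / q) * (1 - q ^+ 2 / t)).

(** At (q^(N+1), t^(N+1)) this is the sum of the complete homogeneous
    polynomials h_n(q, t) over n >= N. *)
Definition frac1 (x y : F) : F := (x / (1 - q) - y / (1 - t)) / (q - t).

(** At (q^(N+1), t^(N+1)) this is the sum of (n + 1 - N) h_n(q, t) over
    n >= N. *)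
Definition frac2 (x y : F) : F :=
  (x / (1 - q) ^+ 2 - y / (1 - t) ^+ 2) / (q - t).

Let tq : t - q != 0. Proof. by rewrite -opprB oppr_eq0. Qed.
Let q2t' : t - q ^+ 2 != 0. Proof. by rewrite -opprB oppr_eq0. Qed.
Let t2q' : q - t ^+ 2 != 0. Proof. by rewrite -opprB oppr_eq0. Qed.

Local Ltac nonzero := rewrite ?q0 ?t0 ?q1 ?t1 ?qt ?q2t ?t2q ?tq ?q2t' ?t2q'.

Lemma four_terms_shift A B C E :
  four_terms (q * A) (q * B) (t * C) (t * E) =
    frac2 (q * ((q * A) ^+ 2 * (q * B))) (t * ((t * C) ^+ 2 * (t * E)))
    + q * t * four_terms A B C E.
Proof. by rewrite /four_terms /frac2; field; nonzero. Qed.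

(** The recursion when d1 = 0: only the exponent d2 decreases. *)
Lemma four_terms_shift1 B E :
  four_terms 1 (q * B) 1 (t * E) =
    frac2 (q * (q * B)) (t * (t * E)) + q * t * four_terms 1 B 1 E.
Proof. by rewrite /four_terms /frac2; field; nonzero. Qed.

Lemma four_terms1 : four_terms 1 1 1 1 = ((1 - q) ^+ 2 * (1 - t) ^+ 2)^-1.
Proof. by rewrite /four_terms; field; nonzero. Qed.

Lemma frac1_base : frac1 q t = 1 / ((1 - q) * (1 - t)).
Proof. by rewrite /frac1; field; nonzero. Qed.

Lemma frac2_base : frac2 q t = (1 - q * t) / ((1 - q) ^+ 2 * (1 - t) ^+ 2).
Proof. by rewrite /frac2; field; nonzero. Qed.

Lemma frac1_step x y S : (q - t) * S = x - y ->
  frac1 (q * x) (t * y) = frac1 x y - S.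
Proof.
by move=> /(canRL (mulKf qt)) ->; rewrite /frac1; field; nonzero.
Qed.

Lemma frac2_step x y : frac2 (q * x) (t * y) = frac2 x y - frac1 x y.
Proof. by rewrite /frac2 /frac1; field; nonzero. Qed.

End RationalFunctions.

(** * Bivariate power series and expansions *)

(** The product of a polynomial and a power series.  All facts about
    expansions follow from its being a module action of the polynomial ring. *)
Definition mul_series (D : {mpoly rat[2]}) (h : nat -> nat -> rat) (m n : nat) : rat :=
  \sum_(i < m.+1) \sum_(j < n.+1) D@_(mon2 i j) * h (m - i)%N (n - j)%N.

Definition series1 (m n : nat) : rat := ((m == 0%N) && (n == 0%N))%:R.

Lemma mon2_eq (u : 'X_{1..2}) i j :
  (u == mon2 i j) = (u ord0 == i) && (u ord_max == j).
Proof.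
apply/eqP/andP => [->|[/eqP h0 /eqP h1]].
  by rewrite !multinomE.
apply/mnmP => k; rewrite multinomE.
case: k => [[|[|k]]] //= hk.
  by rewrite -h0 /=; congr (u _); apply: val_inj.
by rewrite -h1 /=; congr (u _); apply: val_inj.
Qed.

Lemma mul_seriesDl D E h m n :
  mul_series (D + E) h m n = mul_series D h m n + mul_series E h m n.
Proof.
rewrite /mul_series -big_split; apply: eq_bigr => i _ /=.
by rewrite -big_split; apply: eq_bigr => j _; rewrite mcoeffD mulrDl.
Qed.

Lemma mul_seriesZl c D h m n : mul_series (c *: D) h m n = c * mul_series D h m n.
Proof.
rewrite /mul_series mulr_sumr; apply: eq_bigr => i _ /=.
by rewrite mulr_sumr; apply: eq_bigr => j _; rewrite mcoeffZ mulrA.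
Qed.

Lemma mul_series0l h m n : mul_series 0 h m n = 0.
Proof. by rewrite -(scale0r 0) mul_seriesZl mul0r. Qed.

Lemma mul_series_suml (I : Type) (r : seq I) (P : pred I) F h m n :
  mul_series (\sum_(k <- r | P k) F k) h m n = \sum_(k <- r | P k) mul_series (F k) h m n.
Proof.
exact: (big_morph (fun D => mul_series D h m n) (fun D E => mul_seriesDl D E h m n)
  (mul_series0l h m n)).
Qed.

Lemma mul_seriesDr D h1 h2 m n :
  mul_series D (fun i j => h1 i j + h2 i j) m n = mul_series D h1 m n + mul_series D h2 m n.
Proof.
rewrite /mul_series -big_split; apply: eq_bigr => i _ /=.
by rewrite -big_split; apply: eq_bigr => j _; rewrite mulrDr.
Qed.

Lemma mul_seriesZr c D h m n :
  mul_series D (fun i j => c * h i j) m n = c * mul_series D h m n.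
Proof.
rewrite /mul_series mulr_sumr; apply: eq_bigr => i _ /=.
by rewrite mulr_sumr; apply: eq_bigr => j _; rewrite mulrCA.
Qed.

Lemma mul_series_sumr (I : Type) (r : seq I) (P : pred I) D F m n :
  mul_series D (fun i j => \sum_(k <- r | P k) F k i j) m n =
  \sum_(k <- r | P k) mul_series D (F k) m n.
Proof.
rewrite /mul_series [RHS]exchange_big /=; apply: eq_bigr => i _.
rewrite [RHS]exchange_big /=; apply: eq_bigr => j _.
by rewrite mulr_sumr.
Qed.

Lemma eq_mul_series D h1 h2 : (forall i j, h1 i j = h2 i j) ->
  forall m n, mul_series D h1 m n = mul_series D h2 m n.
Proof.
by move=> e m n; apply: eq_bigr => i _; apply: eq_bigr => j _; rewrite e.
Qed.

(** Monomials act by translation of the coefficients; the action of an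
    arbitrary polynomial is then known by linearity. *)
Lemma mul_seriesX u h m n : mul_series 'X_[u] h m n =
  if (u ord0 <= m)%N && (u ord_max <= n)%N
  then h (m - u ord0)%N (n - u ord_max)%N else 0.
Proof.
rewrite /mul_series; under eq_bigr do under eq_bigr do rewrite mcoeffX mon2_eq.
have [hm|hm] /= := leqP (u ord0) m; last first.
  rewrite big1 // => i _; rewrite big1 // => j _.
  by case: eqP => [e|_]; rewrite ?mul0r //; have := ltn_ord i; rewrite -e ltnS leqNgt hm.
have hm' : (u ord0 < m.+1)%N by [].
rewrite (bigD1 (Ordinal hm')) //= [X in _ + X]big1 ?addr0; last first.
  move=> i; rewrite -val_eqE /= eq_sym => /negPf ne; rewrite big1 // => j _.
  by rewrite ne mul0r.
rewrite eqxx /=; have [hn|hn] /= := leqP (u ord_max) n; last first.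
  rewrite big1 // => j _.
  by case: eqP => [e|_]; rewrite ?mul0r //; have := ltn_ord j; rewrite -e ltnS leqNgt hn.
have hn' : (u ord_max < n.+1)%N by [].
rewrite (bigD1 (Ordinal hn')) //= [X in _ + X]big1 ?addr0; last first.
  move=> j; rewrite -val_eqE /= eq_sym => /negPf ne.
  by rewrite ne mul0r.
by rewrite eqxx mul1r.
Qed.

Lemma mul_seriesM D E h m n : mul_series (D * E) h m n = mul_series D (mul_series E h) m n.
Proof.
rewrite {1}(mpolyE D) mulr_suml mul_series_suml [in RHS](mpolyE D) mul_series_suml.
apply: eq_bigr => u _; rewrite -scalerAl !mul_seriesZl; congr (_ * _).
rewrite {1}(mpolyE E) mulr_sumr mul_series_suml.
transitivity (mul_series 'X_[u]
  (fun i j => \sum_(v <- msupp E) E@_v * mul_series 'X_[v] h i j) m n).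
  rewrite mul_series_sumr; apply: eq_bigr => v _.
  rewrite -scalerAr mul_seriesZl mul_seriesZr; congr (_ * _).
  rewrite -mpolyXD !mul_seriesX !mnmDE.
  case: ifP; case: ifP => //; rewrite ?subnDA ?mul_seriesX; try lia.
  - by move=> ? ?; case: ifP => //; lia.
  - by move=> ? ?; case: ifP => //; lia.
apply: eq_mul_series => i j; rewrite [in RHS](mpolyE E) mul_series_suml.
by apply: eq_bigr => v _; rewrite mul_seriesZl.
Qed.

Lemma mul_series1 N m n : mul_series N series1 m n = N@_(mon2 m n).
Proof.
rewrite (mpolyE N) mul_series_suml raddf_sum /=; apply: eq_bigr => u _.
rewrite mul_seriesZl mcoeffZ mul_seriesX mcoeffX mon2_eq /series1; congr (_ * _).
by case: ifP => h; [congr (nat_of_bool _)%:R; lia|case: andP => // -[]; lia].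
Qed.

(** The numerator is the product of N with the series 1, so that both sides
    of the equation are products with a fixed series. *)
Lemma is_expansionP F h : is_expansion F h <->
  exists N D : {mpoly rat[2]}, [/\ D@_0 != 0, F = tofrac N / tofrac D
    & forall m n, mul_series D h m n = mul_series N series1 m n].
Proof.
have e0 : mon2 0 0 = 0%MM by apply/eqP; rewrite eq_sym mon2_eq !mnm0E.
rewrite -e0; split=> -[N [D [D0 FE hE]]].
  exists N, D; split; [exact: D0 | exact: FE |].
  by move=> m n; rewrite mul_series1 -hE.
exists N, D; split; [exact: D0 | exact: FE |].
by move=> m n; rewrite -mul_series1 -hE.
Qed.

Lemma tofrac_neq0 (D : {mpoly rat[2]}) m : D@_m != 0 -> tofrac D != 0.
Proof. by rewrite tofrac_eq0; apply: contraNneq => ->; rewrite mcoeff0. Qed.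

Lemma mcoeff0M (D E : {mpoly rat[2]}) : (D * E)@_0 = D@_0 * E@_0.
Proof. exact: rmorphM (mcoeff 0%MM) D E. Qed.

Lemma eq_is_expansion F h1 h2 : (forall i j, h1 i j = h2 i j) ->
  is_expansion F h1 -> is_expansion F h2.
Proof.
move=> e /is_expansionP[N [D [D0 FE hE]]]; apply/is_expansionP.
exists N, D; split=> // m n; rewrite -hE; apply: eq_mul_series => i j; by rewrite e.
Qed.

Lemma is_expansionD F1 h1 F2 h2 : is_expansion F1 h1 -> is_expansion F2 h2 ->
  is_expansion (F1 + F2) (fun i j => h1 i j + h2 i j).
Proof.
move=> /is_expansionP[N1 [D1 [D10 -> h1E]]] /is_expansionP[N2 [D2 [D20 -> h2E]]].
apply/is_expansionP; exists (N1 * D2 + N2 * D1), (D1 * D2); split.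
- by rewrite mcoeff0M mulf_neq0.
- by rewrite addf_div ?(tofrac_neq0 D10) ?(tofrac_neq0 D20) // rmorphD /= !rmorphM.
- move=> m n; rewrite mul_seriesDr mul_seriesDl; congr (_ + _).
    by rewrite mulrC [N1 * _]mulrC !mul_seriesM; apply: eq_mul_series.
  by rewrite [N2 * _]mulrC !mul_seriesM; apply: eq_mul_series.
Qed.

Lemma is_expansionM P F h : is_expansion F h ->
  is_expansion (tofrac P * F) (mul_series P h).
Proof.
move=> /is_expansionP[N [D [D0 -> hE]]]; apply/is_expansionP.
exists (P * N), D; split=> //; first by rewrite rmorphM mulrA.
by move=> m n; rewrite -mul_seriesM mulrC !mul_seriesM; apply: eq_mul_series.
Qed.

(** Rational generating functions are found by multiplying the series by the
    expected denominator P and recognizing the result. *)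
Lemma is_expansion_div P F h : P@_0 != 0 -> is_expansion F (mul_series P h) ->
  is_expansion (F / tofrac P) h.
Proof.
move=> P0 /is_expansionP[N [D [D0 -> hE]]]; apply/is_expansionP.
exists N, (D * P); split; first by rewrite mcoeff0M mulf_neq0.
  by rewrite rmorphM invfM mulrA.
by move=> m n; rewrite mul_seriesM hE.
Qed.

Lemma is_expansionB F1 h1 F2 h2 : is_expansion F1 h1 -> is_expansion F2 h2 ->
  is_expansion (F1 - F2) (fun i j => h1 i j - h2 i j).
Proof.
move=> e1 /(is_expansionM (- 1)) e2.
have := is_expansionD e1 e2; rewrite rmorphN1 mulN1r.
apply: eq_is_expansion => i j; congr (_ + _).
by rewrite -mpolyX0 -scaleN1r mul_seriesZl mul_seriesX !mnm0E !leq0n !subn0 mulN1r.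
Qed.

Lemma is_expansion_poly N : is_expansion (tofrac N) (fun i j => N@_(mon2 i j)).
Proof.
apply/is_expansionP; exists N, 1; split; first by rewrite mcoeff1 eqxx oner_neq0.
  by rewrite rmorph1 divr1.
by move=> m n; rewrite -mpolyX0 mul_seriesX !mnm0E !leq0n !subn0 mul_series1.
Qed.

Lemma mon2E i j : (mon2 i j ord0 = i) * (mon2 i j ord_max = j).
Proof. by rewrite !multinomE. Qed.

Lemma mul_series1mX u v h m n : mul_series (1 - 'X_[mon2 u v]) h m n =
  h m n - if (u <= m)%N && (v <= n)%N then h (m - u)%N (n - v)%N else 0.
Proof.
rewrite mul_seriesDl -scaleN1r mul_seriesZl mulN1r mul_seriesX !mon2E; congr (_ - _).
by rewrite -mpolyX0 mul_seriesX !mnm0E !leq0n !subn0.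
Qed.

Local Notation Xq := ('X_[mon2 1 0] : {mpoly rat[2]}).
Local Notation Xt := ('X_[mon2 0 1] : {mpoly rat[2]}).

Lemma qvarE : qvar = tofrac Xq.
Proof.
rewrite /qvar; congr (tofrac 'X_[_]).
by apply/eqP; rewrite mon2_eq !mnm1E.
Qed.

Lemma tvarE : tvar = tofrac Xt.
Proof.
rewrite /tvar; congr (tofrac 'X_[_]).
by apply/eqP; rewrite mon2_eq !mnm1E.
Qed.

Lemma mon2XE a b : tofrac 'X_[mon2 a b] = qvar ^+ a * tvar ^+ b.
Proof.
rewrite qvarE tvarE -!rmorphXn -rmorphM !mpolyXn -mpolyXD; congr (tofrac 'X_[_]).
apply/esym/eqP; rewrite mon2_eq !mnmDE !mulmnE !mon2E; lia.
Qed.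

Lemma qt_neq0 :
  [/\ qvar != 0, tvar != 0, 1 - qvar != 0, 1 - tvar != 0 &
   [/\ qvar - tvar != 0, qvar ^+ 2 - tvar != 0 & tvar ^+ 2 - qvar != 0]].
Proof.
rewrite qvarE tvarE -!rmorphXn -(rmorph1 (@tofrac {mpoly rat[2]})) -!rmorphB !mpolyXn.
split; last split.
- by apply: (@tofrac_neq0 _ (mon2 1 0)); rewrite mcoeffX eqxx.
- by apply: (@tofrac_neq0 _ (mon2 0 1)); rewrite mcoeffX eqxx.
- by apply: (@tofrac_neq0 _ (mon2 1 0)); rewrite mcoeffB mcoeffX eqxx mcoeff1
    -mdeg_eq0 mdegE !big_ord_recl big_ord0 !mon2E.
- by apply: (@tofrac_neq0 _ (mon2 0 1)); rewrite mcoeffB mcoeffX eqxx mcoeff1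
    -mdeg_eq0 mdegE !big_ord_recl big_ord0 !mon2E.
- by apply: (@tofrac_neq0 _ (mon2 1 0)); rewrite mcoeffB !mcoeffX !mon2_eq !mon2E.
- by apply: (@tofrac_neq0 _ (mon2 0 1)); rewrite mcoeffB !mcoeffX !mon2_eq ?mulmnE ?mon2E.
- by apply: (@tofrac_neq0 _ (mon2 1 0)); rewrite mcoeffB !mcoeffX !mon2_eq ?mulmnE ?mon2E.
Qed.

Lemma coeff0_1mX u v : (u + v != 0)%N -> (1 - 'X_[mon2 u v] : {mpoly rat[2]})@_0 != 0.
Proof.
move=> uv; rewrite mcoeffB mcoeff1 eqxx mcoeffX (_ : (mon2 u v == 0%MM) = false);
  first by rewrite subr0 oner_neq0.
by apply: contraNF uv => /eqP e; have := mon2E u v; rewrite e !mnm0E => -[<- <-].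
Qed.

Local Notation geom := ((1 - Xq) * (1 - Xt)).

Lemma geom_coeff0 : geom@_0 != 0.
Proof. by rewrite mcoeff0M mulf_neq0 ?coeff0_1mX. Qed.

Lemma geomE : tofrac geom = (1 - qvar) * (1 - tvar).
Proof. by rewrite rmorphM !rmorphB !rmorph1 qvarE tvarE. Qed.

(** Multiplication by (1 - q)(1 - t) is the mixed difference operator. *)
Lemma mul_series_geom h i j : mul_series geom h i j =
  match i, j with
  | 0, 0 => h 0%N 0%N
  | i'.+1, 0 => h i 0%N - h i' 0%N
  | 0, j'.+1 => h 0%N j - h 0%N j'
  | i'.+1, j'.+1 => h i j - h i j' - (h i' j - h i' j')
  end.
Proof.
rewrite mul_seriesM !mul_series1mX.
case: i => [|i]; case: j => [|j] //=; rewrite ?subn0 ?subSS ?subr0 //=.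
all: by rewrite ?mul_series1mX /= ?subn0 ?subSS ?subr0.
Qed.

Definition tail_frac N : ratfun2 := frac1 qvar tvar (qvar ^+ N.+1) (tvar ^+ N.+1).

Definition excess_frac N : ratfun2 := frac2 qvar tvar (qvar ^+ N.+1) (tvar ^+ N.+1).

Lemma coeff1 i j : (1 : {mpoly rat[2]})@_(mon2 i j) = series1 i j.
Proof.
by rewrite -mpolyX0 mcoeffX mon2_eq !mnm0E /series1; congr (nat_of_bool _)%:R; lia.
Qed.

(** The first series is 1 / ((1 - q)(1 - t)), and successive ones differ by the
    polynomial h_N(q, t) = (q^(N+1) - t^(N+1)) / (q - t). *)
Lemma is_expansion_tail N : is_expansion (tail_frac N) (fun i j => (N <= i + j)%N%:R).
Proof.
have [q0 t0 q1 t1 [qt _ _]] := qt_neq0.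
elim: N => [|N IH].
  have -> : tail_frac 0 = tofrac 1 / tofrac geom.
    by rewrite geomE rmorph1 /tail_frac !expr1 frac1_base.
  apply: is_expansion_div geom_coeff0 _; apply: eq_is_expansion (is_expansion_poly 1).
  move=> i j; rewrite mul_series_geom coeff1 /series1.
  by case: i j => [|i] [|j] //=; rewrite !subrr ?subr0.
have -> : tail_frac N.+1 = tail_frac N - tofrac (\sum_(k < N.+1) 'X_[mon2 (N - k) k]).
  rewrite /tail_frac 2!(exprS _ N.+1); apply: frac1_step => //.
  rewrite subrXX rmorph_sum; congr (_ * _).
  by apply: eq_bigr => k _; rewrite /= mon2XE.
apply: eq_is_expansion (is_expansionB IH (is_expansion_poly _)) => i j.
rewrite raddf_sum /=.
under eq_bigr do rewrite mcoeffX mon2_eq !mon2E.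
have [e|ne] := eqVneq (i + j)%N N.
  have hj : (j < N.+1)%N by lia.
  rewrite (bigD1 (Ordinal hj)) //= big1 ?addr0; last first.
    by move=> k; rewrite -val_eqE /= => /negPf ->; rewrite andbF.
  have -> : (N - j == i)%N by apply/eqP; lia.
  have -> : (N <= i + j)%N by lia.
  have -> : (N < i + j)%N = false by lia.
  by rewrite eqxx subrr.
rewrite big1 ?subr0; first by congr (nat_of_bool _)%:R; lia.
by move=> k _; rewrite (_ : _ && _ = false) //; have := ltn_ord k; lia.
Qed.

(** Summation of the previous family:
    max(0, n + 1 - N) - max(0, n - N) is 1 if N <= n and 0 otherwise. *)
Lemma is_expansion_excess N :
  is_expansion (excess_frac N) (fun i j => (i + j + 1 - N)%N%:R).
Proof.
have [q0 t0 q1 t1 [qt h1 h2]] := qt_neq0.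
elim: N => [|N IH]; last first.
  rewrite /excess_frac 2!(exprS _ N.+1) frac2_step // -/(tail_frac N) -/(excess_frac N).
  apply: eq_is_expansion (is_expansionB IH (is_expansion_tail N)) => i j.
  by rewrite -natrB; [congr _%:R; lia|lia].
have -> : excess_frac 0 = tofrac (1 - 'X_[mon2 1 1]) / tofrac geom / tofrac geom.
  rewrite /excess_frac !expr1 frac2_base //.
  by rewrite rmorphB rmorph1 /= mon2XE geomE !expr1 -mulrA -invfM mulrACA -!expr2.
apply: is_expansion_div geom_coeff0 _; apply: is_expansion_div geom_coeff0 _.
apply: eq_is_expansion (is_expansion_poly _) => i j.
rewrite mcoeffB coeff1 mcoeffX mon2_eq !mon2E !mul_series_geom /series1.
case: i j => [|[|i]] [|[|j]]; rewrite ?mul_series_geom //= ?subn0 ?addn0 ?add0n; ring.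
Qed.

(** The recursion given by division by the determinant ad - bc.  Unfolded, it
    counts the irreducible constituents of J under the column action of GL_2
    that have a vector of bidegree (i, j). *)
Fixpoint hilbJ (d1 d2 i j : nat) : nat :=
  (i + j + 1 - (2 * d1 + d2)) +
  match i, j with
  | i'.+1, j'.+1 => hilbJ d1.-1 d2.-1 i' j'
  | _, _ => 0
  end.

(** J(0, 0) is the whole ring, with (i + 1)(j + 1) monomials of bidegree
    (i, j). *)
Lemma hilbJ00 i j : hilbJ 0 0 i j = (i.+1 * j.+1)%N.
Proof. by elim: i j => [|i IH] [|j] /=; rewrite ?IH; lia. Qed.

Lemma is_expansion_hilbJ d1 d2 : (d1 <= d2)%N ->
  is_expansion (hilbert_fun d1 d2) (fun i j => (hilbJ d1 d2 i j)%:R).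
Proof.
have [q0 t0 q1 t1 [qt h1 h2]] := qt_neq0.
have hilbE m n : hilbert_fun m n =
    four_terms qvar tvar (qvar ^+ m) (qvar ^+ n) (tvar ^+ m) (tvar ^+ n).
  by rewrite /hilbert_fun /four_terms [(2 * m)%N]mulnC !exprD !exprM.
elim: d2 d1 => [|d2 IH] d1 hd.
  have -> : d1 = 0%N by lia.
  have -> : hilbert_fun 0 0 = tail_frac 0 / tofrac geom.
    rewrite hilbE !expr0 four_terms1 // /tail_frac !expr1 frac1_base //.
    by rewrite geomE mul1r -invfM -expr2 exprMn.
  apply: is_expansion_div geom_coeff0 _.
  apply: eq_is_expansion (is_expansion_tail 0) => i j.
  by rewrite mul_series_geom; case: i j => [|i] [|j]; 
    rewrite ?hilbJ00 leq0n -[nat_of_bool true]/1%N; ring.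
have -> : hilbert_fun d1 d2.+1 =
    excess_frac (2 * d1 + d2.+1) + tofrac 'X_[mon2 1 1] * hilbert_fun d1.-1 d2.
  rewrite mon2XE !expr1; case: d1 hd => [|d1] hd.
    by rewrite !hilbE !expr0 /excess_frac add0n !(exprS _ d2.+1) !(exprS _ d2)
      four_terms_shift1.
  rewrite !hilbE /excess_frac !(exprS _ (2 * _ + _)) [(2 * _)%N]mulnC !exprD !exprM.
  by rewrite !(exprS _ d1) !(exprS _ d2) four_terms_shift.
have hd' : (d1.-1 <= d2)%N by lia.
apply: eq_is_expansion
  (is_expansionD (is_expansion_excess _) (is_expansionM 'X_[mon2 1 1] (IH _ hd'))).
move=> i j; rewrite mul_seriesX !mon2E.
by case: i j => [|i] [|j] //=; rewrite ?addr0 ?addn0 // !subSS !subn0 natrD.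
Qed.

(** * Powers of ideals and the Rees algebra *)

(** Divisibility by X^n, in a form that passes to coefficientwise maps. *)
Definition low_coef0 (B : nzRingType) n (p : {poly B}) :=
  forall k, (k < n)%N -> p`_k = 0.

Lemma low_coef0D (B : nzRingType) n (p q : {poly B}) :
  low_coef0 n p -> low_coef0 n q -> low_coef0 n (p + q).
Proof. by move=> hp hq k hk; rewrite coefD hp // hq // addr0. Qed.

Lemma low_coef0C (B : nzRingType) n c (p : {poly B}) :
  low_coef0 n p -> low_coef0 n (c%:P * p).
Proof. by move=> hp k hk; rewrite coefCM hp // mulr0. Qed.

Lemma low_coef0_mulXn (B : nzRingType) n m (p : {poly B}) :
  (n <= m)%N -> low_coef0 n (p * 'X^m).
Proof. by move=> hm k hk; rewrite coefMXn (leq_trans hk hm). Qed.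

Lemma low_coef0_map (B : nzRingType) n (f : B -> B) (p : {poly B}) : f 0 = 0 ->
  low_coef0 n p -> low_coef0 n (map_poly f p).
Proof. by move=> f0 hp k hk; rewrite coef_map_id0 // hp. Qed.

Lemma low_coef0_CX (B : idomainType) n (c : B) (p : {poly B}) : c != 0 ->
  low_coef0 n (c%:P * 'X * p) <-> low_coef0 n.-1 p.
Proof.
move=> c0.
have E k : (c%:P * 'X * p)`_k = if k is k'.+1 then c * p`_k' else 0.
  by rewrite -mulrA coefCM coefXM; case: k => [|k] /=; rewrite ?mulr0.
split=> h k hk.
  have := h k.+1; rewrite E => H; have /eqP := H ltac:(lia).
  by rewrite mulf_eq0 (negPf c0) /= => /eqP.
by rewrite E; case: k hk => // k hk; rewrite h ?mulr0 //; lia.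
Qed.

Lemma low_coef0_lin (B : comNzRingType) n (x y : B) p q (r : {poly B}) :
  (n <= p + q)%N -> low_coef0 n ((x%:P * 'X) ^+ p * (y%:P * 'X) ^+ q * r).
Proof.
move=> hn; rewrite !exprMn.
rewrite (_ : _ * r = x%:P ^+ p * y%:P ^+ q * r * 'X^(p + q)).
  exact: low_coef0_mulXn.
by rewrite exprD; ring.
Qed.

Section IdealPowers.
Variable A : comNzRingType.
Implicit Types (S I : A -> Prop) (f g : A).

Lemma ideal_gen_ind S (P : A -> Prop) : P 0 ->
  (forall f g, P f -> P g -> P (f + g)) ->
  (forall r f, S f -> P (r * f)) -> forall f, ideal_gen S f -> P f.
Proof.
move=> P0 PD PM f [k [r [g [Sg ->]]]].
by apply: (big_ind P) => // i _; apply: PM.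
Qed.

Lemma ideal_gen_mem S f : S f -> ideal_gen S f.
Proof.
move=> Sf; exists 1%N, (fun=> 1), (fun=> f).
by split=> //; rewrite big_ord1 mul1r.
Qed.

Lemma ideal_gen0 S : ideal_gen S 0.
Proof.
exists 0%N, (fun=> 0), (fun=> 0).
by split=> [[]|] //; rewrite big_ord0.
Qed.

Lemma ideal_genD S f g : ideal_gen S f -> ideal_gen S g -> ideal_gen S (f + g).
Proof.
move=> [k [r [x [Sx ->]]]] [l [s [y [Sy ->]]]]; exists (k + l)%N.
exists (fun i => match split i with inl i => r i | inr j => s j end).
exists (fun i => match split i with inl i => x i | inr j => y j end).
split=> [i|]; first by case: (split i).
rewrite big_split_ord /=; congr (_ + _); apply: eq_bigr => i _.
  by rewrite (unsplitK (inl _ i)).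
by rewrite (unsplitK (inr _ i)).
Qed.

Lemma ideal_genMl S r f : ideal_gen S f -> ideal_gen S (r * f).
Proof.
move=> [k [s [x [Sx ->]]]]; exists k, (fun i => r * s i), x.
by split=> //; rewrite mulr_sumr; apply: eq_bigr => i _; rewrite mulrA.
Qed.

Lemma ideal_gen_sum S (J : Type) (s : seq J) (P : pred J) (F : J -> A) :
  (forall i, P i -> ideal_gen S (F i)) ->
  ideal_gen S (\sum_(i <- s | P i) F i).
Proof.
move=> h; apply: (big_ind (ideal_gen S)) => //; first exact: ideal_gen0.
exact: ideal_genD.
Qed.

Lemma ideal_pow_all I f : ideal_pow I 0 f.
Proof.
rewrite -[f]mulr1; apply: ideal_genMl; apply: ideal_gen_mem.
by exists (fun=> 0); split=> [[]|] //; rewrite big_ord0.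
Qed.

Lemma ideal_pow_mem I f : I f -> ideal_pow I 1 f.
Proof.
by move=> If; apply: ideal_gen_mem; exists (fun=> f); rewrite big_ord1.
Qed.

Lemma ideal_powM I m n f g :
  ideal_pow I m f -> ideal_pow I n g -> ideal_pow I (m + n) (f * g).
Proof.
move=> If Ig; move: f If.
apply: ideal_gen_ind => [|f1 f2 h1 h2|r _ [x [Ix ->]]].
- by rewrite mul0r; apply: ideal_gen0.
- by rewrite mulrDl; apply: ideal_genD.
rewrite -mulrA; apply: ideal_genMl; move: g Ig.
apply: ideal_gen_ind => [|f1 f2 h1 h2|s _ [y [Iy ->]]].
- by rewrite mulr0; apply: ideal_gen0.
- by rewrite mulrDr; apply: ideal_genD.
rewrite mulrCA; apply: ideal_genMl; apply: ideal_gen_mem.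
exists (fun i => match split i with inl i => x i | inr j => y j end).
split=> [i|]; first by case: (split i).
rewrite big_split_ord /=; congr (_ * _); apply: eq_bigr => i _.
  by rewrite (unsplitK (inl _ i)).
by rewrite (unsplitK (inr _ i)).
Qed.

Lemma ideal_pow_le I m n f : (m <= n)%N -> ideal_pow I n f -> ideal_pow I m f.
Proof.
move=> /subnKC <-; move: (n - m)%N => e; move: f.
apply: ideal_gen_ind => [|f g|r _ [x [Ix ->]]]; first exact: ideal_gen0.
  exact: ideal_genD.
rewrite big_split_ord /= [X in r * X]mulrC; do 2 apply: ideal_genMl.
by apply: ideal_gen_mem; exists (fun i => x (lshift e i)).
Qed.

(** If f sends I into the principal ideal of w, it sends I^n into that of
    w^n. *)
Lemma ideal_pow_image (B : comNzRingType) (f : {rmorphism A -> B}) (w : B) I n :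
  (forall x, I x -> exists r, f x = r * w) ->
  forall x, ideal_pow I n x -> exists r, f x = r * w ^+ n.
Proof.
move=> hI; apply: ideal_gen_ind => [|x y [r hr] [s hs]|s _ [g [Ig ->]]].
- by exists 0; rewrite rmorph0 mul0r.
- by exists (r + s); rewrite rmorphD hr hs mulrDl.
suff [r hr] : exists r, f (\prod_i g i) = r * w ^+ n.
  by exists (f s * r); rewrite rmorphM hr mulrA.
elim: n g Ig => [|n IH] g Ig.
  by exists 1; rewrite big_ord0 rmorph1 expr0 mul1r.
have [r hr] := IH (fun i => g (lift ord0 i)) (fun i => Ig _).
have [r0 hr0] := hI _ (Ig ord0).
by exists (r0 * r); rewrite big_ord_recl rmorphM hr hr0 exprS mulrACA.
Qed.

Lemma ideal_pow2_image (B : comNzRingType) (f : {rmorphism A -> B})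
    (x y : A) (w r s : B) n : f x = r * w -> f y = s * w ->
  forall z, ideal_pow (ideal_gen2 x y) n z -> exists r, f z = r * w ^+ n.
Proof.
move=> hx hy; apply: ideal_pow_image; apply: ideal_gen_ind.
- by exists 0; rewrite rmorph0 mul0r.
- by move=> ? ? [u hu] [v hv]; exists (u + v); rewrite rmorphD hu hv mulrDl.
- move=> u _ [] ->; rewrite rmorphM ?hx ?hy mulrA.
    by exists (f u * r).
  by exists (f u * s).
Qed.

(** Membership in the Rees algebra of I, the sum of the I^k X^k. *)
Definition rees I (p : {poly A}) := forall k, ideal_pow I k p`_k.

Lemma rees_sum I (J : Type) (s : seq J) (P : pred J) (F : J -> {poly A}) :
  (forall i, P i -> rees I (F i)) -> rees I (\sum_(i <- s | P i) F i).
Proof.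
move=> h k; rewrite coef_sum; apply: ideal_gen_sum => i Pi; exact: h.
Qed.

Lemma reesD I p q : rees I p -> rees I q -> rees I (p + q).
Proof. by move=> hp hq k; rewrite coefD; apply: ideal_genD (hp k) (hq k). Qed.

Lemma reesM I p q : rees I p -> rees I q -> rees I (p * q).
Proof.
move=> hp hq k; rewrite coefM; apply: ideal_gen_sum => i _.
have := ideal_powM (hp i) (hq (k - i)%N); rewrite subnKC //.
exact: (ltn_ord i).
Qed.

Lemma reesC I c : rees I c%:P.
Proof.
by move=> [|k]; rewrite coefC /=; [apply: ideal_pow_all|apply: ideal_gen0].
Qed.

Lemma rees_prod I (J : Type) (s : seq J) (P : pred J) (F : J -> {poly A}) :
  (forall i, P i -> rees I (F i)) -> rees I (\prod_(i <- s | P i) F i).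
Proof.
move=> h; apply: (big_ind (rees I)) => //; first exact: (reesC I 1).
exact: reesM.
Qed.

Lemma reesX I p n : rees I p -> rees I (p ^+ n).
Proof.
by move=> hp; elim: n => [|n IH]; 
  [rewrite expr0 -polyC1; apply: reesC|rewrite exprS; apply: reesM].
Qed.

Lemma reesCX I x : I x -> rees I (x%:P * 'X).
Proof.
move=> Ix k; rewrite coefCM coefX; case: k => [|[|k]] /=.
- exact: ideal_pow_all.
- by rewrite mulr1; apply: ideal_pow_mem.
by rewrite mulr0; apply: ideal_gen0.
Qed.

(** Once the terms of degree below n vanish, the value at 1 is a sum of
    elements of I^k with k >= n. *)
Lemma rees_eval1 I p n : rees I p -> low_coef0 n p ->
  ideal_pow I n p.[1].
Proof.
move=> hp p0; rewrite horner_coef; apply: ideal_gen_sum => k _.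
rewrite expr1n mulr1; have [hk|hk] := ltnP k n.
  by rewrite p0 //; apply: ideal_gen0.
exact: ideal_pow_le (hp k).
Qed.

End IdealPowers.

(** * Bihomogeneous polynomials *)

Section Bihomogeneous.
Variable K : fieldType.
Local Notation A := {mpoly K[4]}.
Implicit Types (f g : A) (m : 'X_{1..4}).

Lemma bihom0 i j : bihomog i j (0 : A).
Proof. by move=> m; rewrite msupp0. Qed.

Lemma bihomP i j f :
  bihomog i j f <-> (forall m, bideg m != (i, j) -> f@_m = 0).
Proof.
split=> h m; first by move=> hm; apply/eqP; rewrite mcoeff_eq0; apply: contraNN hm => /h ->.
rewrite mcoeff_msupp => hm; apply/eqP; apply: contraNT hm => /h ->; exact: eqxx.
Qed.

Lemma bihomD i j f g : bihomog i j f -> bihomog i j g -> bihomog i j (f + g).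
Proof.
by move=> /bihomP hf /bihomP hg; apply/bihomP => m hm; rewrite mcoeffD hf // hg // addr0.
Qed.

Lemma bihomZ i j c f : bihomog i j f -> bihomog i j (c *: f).
Proof. by move=> /bihomP hf; apply/bihomP => m hm; rewrite mcoeffZ hf // mulr0. Qed.

Lemma bihomB i j f g : bihomog i j f -> bihomog i j g -> bihomog i j (f - g).
Proof. by move=> hf hg; rewrite -scaleN1r; apply: bihomD => //; apply: bihomZ. Qed.

Lemma bihomM i j k l f g : bihomog i j f -> bihomog k l g ->
  bihomog (i + k) (j + l) (f * g).
Proof.
move=> hf hg m /msuppM_le /allpairsP [[m1 m2] /= [/hf + /hg + ->]].
by rewrite /bideg !mnmDE => -[<- <-] [<- <-]; congr (_, _); lia.
Qed.

Lemma bihomXm m : bihomog (bideg m).1 (bideg m).2 ('X_[m] : A).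
Proof. by move=> m'; rewrite msuppX inE => /eqP ->. Qed.

Lemma bihom1 : bihomog 0 0 (1 : A).
Proof. by move=> m'; rewrite msupp1 inE => /eqP ->; rewrite /bideg !mnm0E. Qed.

Lemma bihomX i j f n : bihomog i j f -> bihomog (i * n) (j * n) (f ^+ n).
Proof.
move=> hf; elim: n => [|n IH]; first by rewrite !muln0; apply: bihom1.
by rewrite exprS !mulnS; apply: bihomM.
Qed.

(** Linearity of [bicomp], which its definition as a sum over the support of f
    hides, can be read off on coefficients. *)
Lemma mcoeff_bicomp i j f m :
  (bicomp i j f)@_m = if bideg m == (i, j) then f@_m else 0.
Proof.
rewrite raddf_sum /= [in RHS](mpolyE f) raddf_sum /= big_mkcond.
case: ifP => hm.
  apply: eq_bigr => m' _; rewrite !mcoeffZ mcoeffX; case: ifP => // hm'.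
  by case: eqP => [e|_]; rewrite ?mulr0 // -e hm' in hm *.
rewrite big1 // => m' _; rewrite mcoeffZ mcoeffX; case: ifP => // hm'.
by case: eqP => [e|_]; rewrite ?mulr0 // -e hm' in hm *.
Qed.

Lemma bicompD i j f g : bicomp i j (f + g) = bicomp i j f + bicomp i j g.
Proof.
apply/mpolyP => m; rewrite mcoeffD !mcoeff_bicomp; case: ifP => _.
  by rewrite mcoeffD.
by rewrite addr0.
Qed.

Lemma bicompZ i j c f : bicomp i j (c *: f) = c *: bicomp i j f.
Proof.
apply/mpolyP => m; rewrite mcoeffZ !mcoeff_bicomp; case: ifP => _.
  by rewrite mcoeffZ.
by rewrite mulr0.
Qed.

Lemma bicomp0 i j : bicomp i j (0 : A) = 0.
Proof. by have := bicompZ i j 0 0; rewrite !scale0r. Qed.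

Lemma bicomp_sum i j (J : Type) (s : seq J) (P : pred J) (F : J -> A) :
  bicomp i j (\sum_(k <- s | P k) F k) = \sum_(k <- s | P k) bicomp i j (F k).
Proof. exact: (big_morph (bicomp i j) (bicompD i j) (bicomp0 i j)). Qed.

Lemma bicomp_id i j f : bihomog i j f -> bicomp i j f = f.
Proof.
move=> /bihomP hf; apply/mpolyP => m; rewrite mcoeff_bicomp.
by case: ifP => // /negbT /hf ->.
Qed.

Lemma bicomp_neq i j k l f : bihomog k l f -> (k, l) != (i, j) ->
  bicomp i j f = 0.
Proof.
move=> /bihomP hf ne; apply/mpolyP => m; rewrite mcoeff_bicomp mcoeff0.
by case: eqP => // e; apply: hf; rewrite e eq_sym.
Qed.

Lemma bihom_bicomp i j f : bihomog i j (bicomp i j f).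
Proof. by apply/bihomP => m /negPf hm; rewrite mcoeff_bicomp hm. Qed.

End Bihomogeneous.

(** * Membership in powers of the three ideals *)

Section LinePolynomials.
Variable B : comNzRingType.
Implicit Types x y : B.

(** The point of parameter X on the line that goes from y at X = 0 to x at
    X = 1. *)
Definition line x y : {poly B} := y%:P + (x - y)%:P * 'X.

Lemma line_id x : line x x = x%:P.
Proof. by rewrite /line subrr polyC0 mul0r addr0. Qed.

Lemma line0 x : line x 0 = x%:P * 'X.
Proof. by rewrite /line subr0 polyC0 add0r. Qed.

Lemma line_diff x y : line x y - line y y = (x - y)%:P * 'X.
Proof. by rewrite line_id /line addrC addKr. Qed.

Variables a b c d : B.

(** The determinant is linear in each row and vanishes when the rows agree,
    so it acquires exactly one factor X when a matrix is moved away from any of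
    the three subspaces. *)
Lemma line_det_ab : line a 0 * line d d - line b 0 * line c c =
  (a * d - b * c)%:P * 'X.
Proof. by rewrite !line0 !line_id polyCB !polyCM; ring. Qed.

Lemma line_det_cd : line a a * line d 0 - line b b * line c 0 =
  (a * d - b * c)%:P * 'X.
Proof. by rewrite !line0 !line_id polyCB !polyCM; ring. Qed.

Lemma line_det_diff : line a c * line d d - line b d * line c c =
  (a * d - b * c)%:P * 'X.
Proof. by rewrite !line_id /line !(polyCB, polyCM); ring. Qed.

End LinePolynomials.

Section Dilation.
Variable K : fieldType.
Local Notation A := {mpoly K[4]}.
Local Notation Xa := ('X_va : A).
Local Notation Xb := ('X_vb : A).
Local Notation Xc := ('X_vc : A).
Local Notation Xd := ('X_vd : A).
Implicit Types (f g : A) (m : 'X_{1..4}) (u : 'I_4 -> A).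

Lemma ord4_ind (P : 'I_4 -> Prop) : P va -> P vb -> P vc -> P vd -> forall i, P i.
Proof.
move=> ha hb hc hd [[|[|[|[|k]]]] hk] //.
- by rewrite (_ : Ordinal hk = va) //; apply: val_inj.
- by rewrite (_ : Ordinal hk = vb) //; apply: val_inj.
- by rewrite (_ : Ordinal hk = vc) //; apply: val_inj.
- by rewrite (_ : Ordinal hk = vd) //; apply: val_inj.
Qed.

Lemma prod4 (B : comNzRingType) (F : 'I_4 -> B) :
  \prod_i F i = F va * F vb * F vc * F vd.
Proof.
rewrite !big_ord_recl big_ord0 mulr1 !mulrA.
by congr (F _ * F _ * F _ * F _); apply: val_inj.
Qed.

(** Here u is a linear projection of the space of matrices onto a subspace,
    given by the images of the coordinates; [dilate u f] is f on the line from
    the projection of a matrix to the matrix itself. *)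
Definition dilate_var u i : {poly A} := line 'X_i (u i).

Definition dilate u : {rmorphism A -> {poly A}} :=
  mmap (polyC \o @mpolyC 4 K) (dilate_var u).

Lemma dilateX u i : dilate u 'X_i = dilate_var u i.
Proof. by rewrite /= mmapX mmap1U. Qed.

Lemma dilateXm u m : dilate u 'X_[m] = \prod_i dilate_var u i ^+ m i.
Proof. by rewrite /= mmapX. Qed.

Lemma dilateZ u c f : dilate u (c *: f) = c%:MP%:P * dilate u f.
Proof. by rewrite /= mmapZ. Qed.

Lemma coef_dilateZ u c f k : (dilate u (c *: f))`_k = c *: (dilate u f)`_k.
Proof. by rewrite dilateZ coefCM mul_mpolyC. Qed.

Lemma dilateD u : {morph dilate u : f g / f + g}. Proof. exact: rmorphD. Qed.
Lemma dilateB u : {morph dilate u : f g / f - g}. Proof. exact: rmorphB. Qed.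
Lemma dilateM u : {morph dilate u : f g / f * g}. Proof. exact: rmorphM. Qed.
Lemma dilate_exp u n : {morph dilate u : f / f ^+ n}. Proof. exact: rmorphXn. Qed.
Lemma dilate_sum u (J : Type) (s : seq J) (P : pred J) (F : J -> A) :
  dilate u (\sum_(k <- s | P k) F k) = \sum_(k <- s | P k) dilate u (F k).
Proof. exact: rmorph_sum. Qed.

Local Opaque dilate.

Lemma dilateE u f : dilate u f = \sum_(m <- msupp f) dilate u (f@_m *: 'X_[m]).
Proof. by rewrite {1}(mpolyE f) dilate_sum. Qed.

Lemma dilate_eval1 u f : (dilate u f).[1] = f.
Proof.
rewrite dilateE horner_sum [RHS]mpolyE; apply: eq_bigr => m _.
rewrite dilateZ hornerM hornerC dilateXm horner_prod mul_mpolyC mpolyXE_id.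
congr (_ *: _); apply: eq_bigr => i _.
by rewrite horner_exp /dilate_var /line hornerD hornerM !hornerC hornerX mulr1 addrC subrK.
Qed.

(** The ideal of the subspace contains each ['X_i - u i], the coefficient of X
    in the i-th coordinate of the line. *)
Lemma dilate_rees u (I : A -> Prop) f :
  (forall i, I ('X_i - u i)) -> rees I (dilate u f).
Proof.
move=> hI; rewrite dilateE; apply: rees_sum => m _.
rewrite dilateZ; apply: reesM (reesC _ _) _; rewrite dilateXm; apply: rees_prod => i _.
by apply: reesX; apply: reesD (reesC _ _) (reesCX _).
Qed.

(** Vanishing to order at least n along the image of the projection u. *)
Definition order_ge u n f := low_coef0 n (dilate u f).

(** From left to right, each generator x, y acquires a factor X; from right to
    left, f is the value at X = 1 of an element of the Rees algebra. *)
Lemma order_geP u x y n f : (forall i, ideal_gen2 x y ('X_i - u i)) ->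
  dilate u x = x%:P * 'X -> dilate u y = y%:P * 'X ->
  ideal_pow (ideal_gen2 x y) n f <-> order_ge u n f.
Proof.
move=> hI hx hy; split=> [|hf].
  move=> /(ideal_pow2_image (f := dilate u) hx hy)[r hr].
  by rewrite /order_ge hr; apply: low_coef0_mulXn.
by rewrite -(dilate_eval1 u f); apply: rees_eval1 (dilate_rees f hI) hf.
Qed.

Lemma order_geD u n f g : order_ge u n f -> order_ge u n g -> order_ge u n (f + g).
Proof. by rewrite /order_ge dilateD; apply: low_coef0D. Qed.

Lemma order_geZ u n c f : order_ge u n f -> order_ge u n (c *: f).
Proof. by rewrite /order_ge dilateZ; apply: low_coef0C. Qed.

Definition graded_base u :=
  forall i, bihomog (bideg U_(i)).1 (bideg U_(i)).2 (u i).

Definition cbihom i j (p : {poly A}) := forall k, bihomog i j p`_k.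

Lemma bihom_sum i j (J : Type) (s : seq J) (P : pred J) (F : J -> A) :
  (forall k, P k -> bihomog i j (F k)) -> bihomog i j (\sum_(k <- s | P k) F k).
Proof.
move=> h; apply: (big_ind (bihomog i j)) => //; first exact: bihom0.
exact: bihomD.
Qed.

Lemma cbihomM i j k l p q : cbihom i j p -> cbihom k l q ->
  cbihom (i + k) (j + l) (p * q).
Proof.
move=> hp hq e; rewrite coefM; apply: bihom_sum => e' _; exact: bihomM.
Qed.

Lemma cbihomX i j p n : cbihom i j p -> cbihom (i * n) (j * n) (p ^+ n).
Proof.
move=> hp; elim: n => [|n IH]; last by rewrite exprS !mulnS; apply: cbihomM.
move=> k; rewrite expr0 coef1 !muln0; case: eqP => _; last exact: bihom0.
exact: bihom1.
Qed.

Lemma cbihom_dilate_var u i : graded_base u ->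
  cbihom (bideg U_(i)).1 (bideg U_(i)).2 (dilate_var u i).
Proof.
move=> hu [|[|k]]; rewrite /dilate_var /line coefD coefC coefCM coefX /= ?mulr0 ?addr0 //.
- exact: hu.
- by rewrite mulr1 add0r; apply: bihomB (hu i); apply: bihomXm.
- exact: bihom0.
Qed.

Lemma cbihom_dilateXm u m : graded_base u ->
  cbihom (bideg m).1 (bideg m).2 (dilate u 'X_[m]).
Proof.
move=> hu; rewrite dilateXm prod4 /bideg /=.
have h i := @cbihomX _ _ _ (m i) (@cbihom_dilate_var u i hu).
have := cbihomM (cbihomM (cbihomM (h va) (h vb)) (h vc)) (h vd).
rewrite /bideg !mnm1E /= !mul1n !mul0n !addn0 !add0n; exact.
Qed.

Lemma coef_dilate_comb u f (P : pred 'X_{1..4}) k :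
  (dilate u (\sum_(m <- msupp f | P m) f@_m *: 'X_[m]))`_k =
  \sum_(m <- msupp f | P m) f@_m *: (dilate u 'X_[m])`_k.
Proof.
by rewrite dilate_sum coef_sum; apply: eq_bigr => m _; exact: coef_dilateZ.
Qed.

(** Bigradedness of the powers of ideals follows from this: moving along the
    line is compatible with the bigrading, as u respects bidegrees. *)
Lemma dilate_bicomp u i j f : graded_base u ->
  dilate u (bicomp i j f) = map_poly (bicomp i j) (dilate u f).
Proof.
move=> hu; apply/polyP => k; rewrite coef_map_id0 ?bicomp0 //.
have E : (dilate u f)`_k = \sum_(m <- msupp f) f@_m *: (dilate u 'X_[m])`_k.
  by rewrite {1}(mpolyE f); exact: coef_dilate_comb.
apply: etrans (coef_dilate_comb u f _ k) _; apply: esym.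
apply: etrans (congr1 (bicomp i j) E) _.
rewrite bicomp_sum [RHS]big_mkcond /=; apply: eq_bigr => m _.
rewrite bicompZ; have hm := @cbihom_dilateXm u m hu k.
case: eqP => [e|/eqP ne]; first by rewrite e in hm; rewrite (bicomp_id hm).
by rewrite (bicomp_neq hm) ?scaler0 // -surjective_pairing.
Qed.

Lemma order_ge_bicomp u n i j f : graded_base u ->
  order_ge u n f -> order_ge u n (bicomp i j f).
Proof.
move=> hu hf; rewrite /order_ge dilate_bicomp //.
exact: low_coef0_map (bicomp0 _ _ _) hf.
Qed.

Lemma order_ge_lin u x y n p q r : dilate u x = x%:P * 'X -> dilate u y = y%:P * 'X ->
  (n <= p + q)%N -> order_ge u n (x ^+ p * y ^+ q * r).
Proof.
move=> hx hy hn; rewrite /order_ge !dilateM !dilate_exp hx hy; exact: low_coef0_lin.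
Qed.

(** The projections onto the subspaces a = b = 0, c = d = 0 and
    (a, b) = (c, d); the last one replaces the first row by the second. *)
Definition base_ab (i : 'I_4) : A := [:: 0; 0; Xc; Xd]`_i.
Definition base_cd (i : 'I_4) : A := [:: Xa; Xb; 0; 0]`_i.
Definition base_diff (i : 'I_4) : A := [:: Xc; Xd; Xc; Xd]`_i.

Lemma graded_base_ab : graded_base base_ab.
Proof.
by apply: ord4_ind; rewrite /base_ab /=; (exact: bihom0 || exact: bihomXm).
Qed.

Lemma graded_base_cd : graded_base base_cd.
Proof.
by apply: ord4_ind; rewrite /base_cd /=; (exact: bihom0 || exact: bihomXm).
Qed.

Lemma graded_base_diff : graded_base base_diff.
Proof.
apply: ord4_ind; rewrite /base_diff /=; try exact: bihomXm.
- by have := @bihomXm K U_(vc); rewrite /bideg !mnm1E.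
- by have := @bihomXm K U_(vd); rewrite /bideg !mnm1E.
Qed.

Lemma dilate_base_ab : dilate base_ab Xa = Xa%:P * 'X /\ dilate base_ab Xb = Xb%:P * 'X.
Proof. by split; rewrite dilateX; exact: line0. Qed.

Lemma dilate_base_cd : dilate base_cd Xc = Xc%:P * 'X /\ dilate base_cd Xd = Xd%:P * 'X.
Proof. by split; rewrite dilateX; exact: line0. Qed.

Lemma dilate_base_diff : dilate base_diff (Xa - Xc) = (Xa - Xc)%:P * 'X /\
  dilate base_diff (Xb - Xd) = (Xb - Xd)%:P * 'X.
Proof. by split; rewrite dilateB !dilateX; exact: line_diff. Qed.

Lemma gen2_0 (x y : A) : ideal_gen2 x y 0. Proof. exact: ideal_gen0. Qed.
Lemma gen2_l (x y : A) : ideal_gen2 x y x.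
Proof. by apply: ideal_gen_mem; left. Qed.
Lemma gen2_r (x y : A) : ideal_gen2 x y y.
Proof. by apply: ideal_gen_mem; right. Qed.

Lemma base_abP i : ideal_gen2 Xa Xb ('X_i - base_ab i).
Proof.
move: i; apply: ord4_ind; rewrite /base_ab [nth _ _ _]/= ?subr0 ?subrr.
- exact: gen2_l.
- exact: gen2_r.
- exact: gen2_0.
- exact: gen2_0.
Qed.

Lemma base_cdP i : ideal_gen2 Xc Xd ('X_i - base_cd i).
Proof.
move: i; apply: ord4_ind; rewrite /base_cd [nth _ _ _]/= ?subr0 ?subrr.
- exact: gen2_0.
- exact: gen2_0.
- exact: gen2_l.
- exact: gen2_r.
Qed.

Lemma base_diffP i : ideal_gen2 (Xa - Xc) (Xb - Xd) ('X_i - base_diff i).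
Proof.
move: i; apply: ord4_ind; rewrite /base_diff [nth _ _ _]/= ?subrr.
- exact: gen2_l.
- exact: gen2_r.
- exact: gen2_0.
- exact: gen2_0.
Qed.

Lemma idealJP d1 d2 f : idealJ d1 d2 f <->
  [/\ order_ge base_ab d1 f, order_ge base_cd d2 f & order_ge base_diff d1 f].
Proof.
have Pab := order_geP d1 f base_abP dilate_base_ab.1 dilate_base_ab.2.
have Pcd := order_geP d2 f base_cdP dilate_base_cd.1 dilate_base_cd.2.
have Pdf := order_geP d1 f base_diffP dilate_base_diff.1 dilate_base_diff.2.
split=> -[h1 h2 h3]; split.
- exact: (proj1 Pab h1).
- exact: (proj1 Pcd h2).
- exact: (proj1 Pdf h3).
- exact: (proj2 Pab h1).
- exact: (proj2 Pcd h2).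
- exact: (proj2 Pdf h3).
Qed.

Definition Delta : A := Xa * Xd - Xb * Xc.

Lemma dilate_Delta u : u = base_ab \/ u = base_cd \/ u = base_diff ->
  dilate u Delta = Delta%:P * 'X.
Proof.
rewrite /Delta dilateB !dilateM !dilateX.
by move=> -[->|[->|->]]; [exact: line_det_ab|exact: line_det_cd|exact: line_det_diff].
Qed.

Lemma Delta_neq0 : Delta != 0.
Proof.
apply/eqP => /(congr1 (mcoeff (U_(va) + U_(vd))%MM)).
rewrite mcoeff0 mcoeffB -!mpolyXD !mcoeffX eqxx.
case: eqP => [/(congr1 (fun m : 'X_{1..4} => m va))|_].
  by rewrite !mnmDE !mnm1E.
by rewrite subr0 => /eqP; rewrite oner_eq0.
Qed.

Lemma order_ge_Delta u n f : dilate u Delta = Delta%:P * 'X ->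
  order_ge u n (Delta * f) <-> order_ge u n.-1 f.
Proof.
move=> hD; rewrite /order_ge dilateM hD; exact: low_coef0_CX Delta_neq0.
Qed.

Lemma bihom_Delta : bihomog 1 1 Delta.
Proof.
have hX i := @bihomXm K U_(i).
apply: bihomB.
  by have := bihomM (hX va) (hX vd); rewrite /bideg !mnm1E.
by have := bihomM (hX vb) (hX vc); rewrite /bideg !mnm1E.
Qed.

(** Each of the three orders of vanishing drops by exactly 1 on division by
    Delta, as the coefficients lie in a domain. *)
Lemma idealJ_Delta d1 d2 f : idealJ d1 d2 (Delta * f) <-> idealJ d1.-1 d2.-1 f.
Proof.
have h1 n := @order_ge_Delta base_ab n f (dilate_Delta (or_introl erefl)).
have h2 n := @order_ge_Delta base_cd n f (dilate_Delta (or_intror (or_introl erefl))).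
have h3 n := @order_ge_Delta base_diff n f (dilate_Delta (or_intror (or_intror erefl))).
split=> /idealJP [a b c]; apply/idealJP.
  exact: And3 (proj1 (h1 _) a) (proj1 (h2 _) b) (proj1 (h3 _) c).
exact: And3 (proj2 (h1 _) a) (proj2 (h2 _) b) (proj2 (h3 _) c).
Qed.

Lemma bigraded_idealJ d1 d2 : bigraded (@idealJ K d1 d2).
Proof.
move=> f /idealJP[h1 h2 h3] i j; apply/idealJP; split.
- exact: order_ge_bicomp graded_base_ab h1.
- exact: order_ge_bicomp graded_base_cd h2.
- exact: order_ge_bicomp graded_base_diff h3.
Qed.

(** Multiplication by Delta shifts the bidegree by (1, 1): the cofactor of a
    bihomogeneous multiple of Delta is bihomogeneous, and multiples of Delta
    have no component of bidegree (0, j) or (i, 0). *)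
Lemma bicomp_Delta i j f :
  bicomp i j (Delta * f) =
  if (i == 0%N) || (j == 0%N) then 0 else Delta * bicomp i.-1 j.-1 f.
Proof.
rewrite {1}(mpolyE f) mulr_sumr bicomp_sum.
have E m : bicomp i j (Delta * (f@_m *: 'X_[m])) =
    if (i == 0%N) || (j == 0%N) then 0 else
    if bideg m == (i.-1, j.-1) then Delta * (f@_m *: 'X_[m]) else 0.
  have hm := bihomM bihom_Delta (@bihomXm K m).
  rewrite -scalerAr bicompZ; case: ifP => hij.
    rewrite (bicomp_neq hm) ?scaler0 //; apply/eqP => -[]; lia.
  case: eqP => [e|ne].
    have hm' : bihomog i j (Delta * 'X_[m]).
      by move: hm; rewrite e /= !add1n !prednK //; lia.
    by rewrite (bicomp_id hm').
  rewrite (bicomp_neq hm) ?scaler0 //; apply/eqP => -[e1 e2]; apply: ne.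
  by rewrite [LHS]surjective_pairing -e1 -e2.
under eq_bigr do rewrite E.
case: ifP => _; first by rewrite big1.
by rewrite -big_mkcond /= mulr_sumr.
Qed.

End Dilation.

(** * Restriction to matrices with equal columns *)

Section Restriction.
Variable K : fieldType.
Local Notation A := {mpoly K[4]}.
Local Notation Xa := ('X_va : A).
Local Notation Xb := ('X_vb : A).
Local Notation Xc := ('X_vc : A).
Local Notation Xd := ('X_vd : A).
Local Notation Delta := (Delta K).
Implicit Types (f g : A) (m : 'X_{1..4}).

(** Matrices with equal columns: both entries of the first row are x, both
    entries of the second row are y. *)
Definition row_var (x y : {poly K}) (i : 'I_4) : {poly K} := [:: x; x; y; y]`_i.

Definition eval_rows x y : A -> {poly K} := mmap (@polyC K) (row_var x y).

HB.instance Definition _ x y := GRing.RMorphism.on (eval_rows x y).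

Lemma eval_rowsX x y i : eval_rows x y 'X_i = row_var x y i.
Proof. by rewrite /eval_rows mmapX mmap1U. Qed.

Lemma eval_rowsZ x y c f : eval_rows x y (c *: f) = c *: eval_rows x y f.
Proof. by rewrite /eval_rows mmapZ mul_polyC. Qed.

HB.instance Definition _ x y :=
  GRing.isScalable.Build K A {poly K} *:%R (eval_rows x y) (eval_rowsZ x y).

Lemma eval_rowsXm x y m : eval_rows x y 'X_[m] = x ^+ (m va + m vb) * y ^+ (m vc + m vd).
Proof. by rewrite /eval_rows mmapX /mmap1 prod4 /row_var /= !exprD !mulrA. Qed.

Lemma eval_rows_coef x y f e : (eval_rows x y f)`_e =
  \sum_(m <- msupp f) f@_m * (x ^+ (m va + m vb) * y ^+ (m vc + m vd))`_e.
Proof.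
rewrite {1}(mpolyE f) linear_sum coef_sum; apply: eq_bigr => m _.
by rewrite /= eval_rowsZ coefZ eval_rowsXm.
Qed.

Local Notation restr := (eval_rows 'X 1).

Lemma restr_Delta f : restr (Delta * f) = 0.
Proof.
rewrite rmorphM rmorphB !rmorphM /= !eval_rowsX /row_var.
rewrite [_`_va]/= [_`_vb]/= [_`_vc]/= [_`_vd]/=.
by rewrite subrr mul0r.
Qed.

(** Exchanging the rows turns X^e into X^(i+j-e) on bidegree (i, j), so that
    divisibility by X^d after the exchange is a degree bound. *)
Lemma size_restr i j d f : bihomog i j f ->
  ideal_pow (ideal_gen2 Xc Xd) d f -> (size (restr f) <= i + j + 1 - d)%N.
Proof.
move=> hf hI; apply/leq_sizeP => e he.
have hm m : m \in msupp f -> (m va + m vb + (m vc + m vd) = i + j)%N.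
  by move=> /hf; rewrite /bideg => -[<- <-]; lia.
have [he'|he'] := ltnP (i + j) e.
  rewrite eval_rows_coef big_seq big1 // => m /hm hm'.
  by rewrite expr1n mulr1 coefXn; case: eqP; rewrite ?mulr0 //; lia.
(* the row exchange: X^(ma + mb) becomes X^(mc + md) *)
have -> : (restr f)`_e = (eval_rows 1 'X f)`_(i + j - e).
  rewrite !eval_rows_coef !big_seq; apply: eq_bigr => m /hm hm'.
  rewrite !expr1n mulr1 mul1r !coefXn; congr (_ * (nat_of_bool _)%:R); lia.
have hc : eval_rows 1 'X Xc = 1 * 'X by rewrite eval_rowsX mul1r.
have hd : eval_rows 1 'X Xd = 1 * 'X by rewrite eval_rowsX mul1r.
have [r hr] := ideal_pow2_image (f := eval_rows 1 'X) hc hd hI.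
by rewrite [eval_rows 1 'X f]hr coefMXn; case: ifP => //; lia.
Qed.

Lemma restr_dvd_ab d f : ideal_pow (ideal_gen2 Xa Xb) d f -> 'X^d %| restr f.
Proof.
have ha : restr Xa = 1 * 'X by rewrite eval_rowsX mul1r.
have hb : restr Xb = 1 * 'X by rewrite eval_rowsX mul1r.
by move=> /(ideal_pow2_image (f := restr) ha hb)[r hr]; rewrite [restr f]hr dvdp_mull.
Qed.

Lemma restr_dvd_diff d f : ideal_pow (ideal_gen2 (Xa - Xc) (Xb - Xd)) d f ->
  ('X - 1) ^+ d %| restr f.
Proof.
have ha : restr (Xa - Xc) = 1 * ('X - 1) by rewrite rmorphB /= !eval_rowsX mul1r.
have hb : restr (Xb - Xd) = 1 * ('X - 1) by rewrite rmorphB /= !eval_rowsX mul1r.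
by move=> /(ideal_pow2_image (f := restr) ha hb)[r hr]; rewrite [restr f]hr dvdp_mull.
Qed.

(** The monomial of bidegree (i, j) with restriction X^e that is not divisible
    by ad; the truncated subtractions make it a^(e-j) b^j c^(i+j-e) if j <= e
    and b^e c^i d^(j-e) if e <= j. *)
Definition std_mon i j e : A :=
  Xa ^+ (e - j) * Xb ^+ minn e j * Xc ^+ (i - (e - j)) * Xd ^+ (j - e).

(** Replacing (ad)^r by (bc)^r does not change the class modulo ad - bc. *)
Lemma straighten (B : comNzRingType) (a b c d : B) (r k l s t : nat) :
  exists h, a ^+ (k + r) * b ^+ l * c ^+ s * d ^+ (t + r) =
    (a * d - b * c) * h + a ^+ k * b ^+ (l + r) * c ^+ (s + r) * d ^+ t.
Proof.
pose M := a ^+ k * b ^+ l * c ^+ s * d ^+ t.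
exists ((\sum_(i < r) (a * d) ^+ (r.-1 - i) * (b * c) ^+ i) * M).
rewrite mulrA -subrXX !exprMn !exprD /M; ring.
Qed.

Lemma straighten_mon m : exists g,
  'X_[m] = Delta * g + std_mon (m va + m vc) (m vb + m vd) (m va + m vb).
Proof.
(* the largest power of ad that divides the monomial *)
pose r := minn (m va) (m vd).
have [g hg] := straighten Xa Xb Xc Xd r (m va - r) (m vb) (m vc) (m vd - r).
exists g; rewrite mpolyXE_id prod4.
have ea : (m va - r + r)%N = m va by rewrite /r; lia.
have ed : (m vd - r + r)%N = m vd by rewrite /r; lia.
rewrite ea ed in hg; rewrite hg /Delta /std_mon; congr (_ + _).
congr (_ ^+ _ * _ ^+ _ * _ ^+ _ * _ ^+ _); rewrite /r; lia.
Qed.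

(** The coefficients of the standard monomials are those of the restriction,
    because multiples of Delta restrict to 0 and the e-th standard monomial
    restricts to X^e. *)
Lemma std_form i j f : bihomog i j f ->
  exists g, f = Delta * g + \sum_(e < i + j + 1) (restr f)`_e *: std_mon i j e.
Proof.
move=> hf.
pose Q f := exists g, f = Delta * g + \sum_(e < i + j + 1) (restr f)`_e *: std_mon i j e.
rewrite -/(Q f) (mpolyE f) big_seq; apply: (big_ind Q).
- exists 0; rewrite mulr0 add0r linear0 big1 // => e _.
  by rewrite coef0 scale0r.
- move=> f1 f2 [g1 h1] [g2 h2]; exists (g1 + g2).
  rewrite {1}h1 {1}h2 mulrDr addrACA -big_split /= linearD; congr (_ + _).
  by apply: eq_bigr => e _; rewrite coefD scalerDl.
move=> m /hf; rewrite /bideg => -[ei ej].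
have [g hg] := straighten_mon m; exists (f@_m *: g).
have he : (m va + m vb < i + j + 1)%N by lia.
rewrite eval_rowsZ eval_rowsXm expr1n mulr1 (bigD1 (Ordinal he)) //=.
rewrite coefZ coefXn eqxx mulr1.
rewrite big1 ?addr0; last first.
  move=> e; rewrite -val_eqE /= => /negPf ne.
  by rewrite coefZ coefXn ne mulr0 scale0r.
by rewrite -scalerAr -scalerDr -ei -ej -hg.
Qed.

Lemma restr_ker i j f : bihomog i j f -> restr f = 0 -> exists g, f = Delta * g.
Proof.
move=> hf f0; have [g] := std_form hf; rewrite f0 big1 ?addr0; first by exists g.
by move=> e _; rewrite coef0 scale0r.
Qed.

End Restriction.

(** * Dimensions of the bigraded pieces *)

Section DimensionExtension.
Variables (K : fieldType) (P : lmodType K).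
Local Notation A := {mpoly K[4]}.

(** The dimension formula for an exact sequence 0 -> V0 -> V -> W -> 0, where W
    is given by the basis b of the image of V under phi and u lifts b. *)
Lemma has_dim_extension (V V0 : A -> Prop) (mu : {linear A -> A})
    (phi : {linear A -> P}) n k (b : 'I_n -> P) (u : 'I_n -> A) :
  (forall f g, V f -> V g -> V (f + g)) -> (forall c f, V f -> V (c *: f)) ->
  injective mu -> (forall g, phi (mu g) = 0) ->
  (forall g, V0 g -> V (mu g)) ->
  (forall f, V f -> phi f = 0 -> exists2 g, V0 g & f = mu g) ->
  (forall i, V (u i)) -> (forall i, phi (u i) = b i) ->
  (forall c : 'I_n -> K, \sum_i c i *: b i = 0 -> forall i, c i = 0) ->
  (forall f, V f -> exists c : 'I_n -> K, phi f = \sum_i c i *: b i) ->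
  has_dim V0 k -> has_dim V (n + k)%N.
Proof.
move=> VD VZ muI phimu muV kerV uV phiu bfree bspan [e [eV efree espan]].
pose E i := match split i with inl i => u i | inr j => mu (e j) end.
have El i : E (lshift k i) = u i by rewrite /E (unsplitK (inl _ i)).
have Er j : E (rshift n j) = mu (e j) by rewrite /E (unsplitK (inr _ j)).
have Esum c : \sum_i c i *: E i = \sum_i c (lshift k i) *: u i
    + mu (\sum_j c (rshift n j) *: e j).
  rewrite big_split_ord; congr (_ + _); first by apply: eq_bigr => i _; rewrite El.
  by rewrite linear_sum; apply: eq_bigr => j _; rewrite Er linearZ.
have phisum (c : 'I_n -> K) : phi (\sum_i c i *: u i) = \sum_i c i *: b i.
  by rewrite linear_sum; apply: eq_bigr => i _; rewrite linearZ /= phiu.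
exists E; split.
- by move=> i; rewrite /E; case: (split i) => j; [exact: uV|exact/muV/eV].
- move=> c; rewrite Esum => h0.
  have cl i : c (lshift k i) = 0.
    apply: (bfree (fun i => c (lshift k i))); rewrite -phisum.
    by have := congr1 phi h0; rewrite linearD phimu addr0 linear0.
  move: h0; rewrite big1 ?add0r => [h0|i _]; last by rewrite cl scale0r.
  have cr : \sum_j c (rshift n j) *: e j = 0 by apply: muI; rewrite h0 linear0.
  move=> i; rewrite -(splitK i); case: (split i) => j /=; first exact: cl.
  exact: (efree (fun j => c (rshift n j)) cr j).
- move=> f Vf; have [c hc] := bspan f Vf.
  have VS : V (\sum_i c i *: u i).
    apply: (big_ind V) => //; last by move=> i _; apply/VZ/uV.
    by have := VZ 0 f Vf; rewrite scale0r.
  have Vr : V (f - \sum_i c i *: u i).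
    by apply: VD => //; rewrite -scaleN1r; apply: VZ.
  have [g V0g hg] : exists2 g, V0 g & f - \sum_i c i *: u i = mu g.
    by apply: kerV => //; rewrite linearB /= phisum hc subrr.
  have [c' hc'] := espan g V0g.
  exists (fun i => match split i with inl i => c i | inr j => c' j end).
  rewrite Esum -[LHS](subrK (\sum_i c i *: u i)) hg addrC hc'; congr (_ + _).
    by apply: eq_bigr => i _; rewrite (unsplitK (inl _ i)).
  by congr (mu _); apply: eq_bigr => i _; rewrite (unsplitK (inr _ i)).
Qed.

End DimensionExtension.

(** Among i + j linear forms of three kinds, i can be chosen to be in the
    first column: take as many as possible of each kind in turn. *)
Lemma distribute_factors p r s i j : (p + r + s = i + j)%N ->
  exists p1 r1 s1, [/\ (p1 <= p)%N, (r1 <= r)%N, (s1 <= s)%N,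
    (p1 + r1 + s1 = i)%N & (p - p1 + (r - r1) + (s - s1) = j)%N].
Proof.
move=> h; have [hi|hi] := leqP i p; first by exists i, 0%N, 0%N; split; lia.
have [hi'|hi'] := leqP i (p + r); first by exists p, (i - p)%N, 0%N; split; lia.
by exists p, r, (i - p - r)%N; split; lia.
Qed.

Section Dimension.
Variable K : fieldType.
Local Notation A := {mpoly K[4]}.
Local Notation Xa := ('X_va : A).
Local Notation Xb := ('X_vb : A).
Local Notation Xc := ('X_vc : A).
Local Notation Xd := ('X_vd : A).
Local Notation Delta := (Delta K).
Local Notation restr := (eval_rows 'X 1).
Implicit Types (f g : A).

Definition mulDelta : A -> A := fun f => Delta * f.

Lemma mulDelta_is_linear : linear mulDelta.
Proof. by move=> c f g; rewrite /mulDelta mulrDr scalerAr. Qed.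

HB.instance Definition _ :=
  GRing.isLinear.Build K A A *:%R mulDelta mulDelta_is_linear.

(** The linear forms come in the three pairs (a, b), (a-c, b-d), (c, d) that
    generate the ideals; p1, r1, s1 count the forms of the first column. *)
Definition lin_prod p1 p2 r1 r2 s1 s2 : A :=
  Xa ^+ p1 * Xb ^+ p2 * ((Xa - Xc) ^+ r1 * (Xb - Xd) ^+ r2) *
  (Xc ^+ s1 * Xd ^+ s2).

Lemma lin_prod_idealJ d1 d2 p1 p2 r1 r2 s1 s2 :
  (d1 <= p1 + p2)%N -> (d1 <= r1 + r2)%N -> (d2 <= s1 + s2)%N ->
  idealJ d1 d2 (lin_prod p1 p2 r1 r2 s1 s2).
Proof.
move=> hp hr hs; apply/idealJP; rewrite /lin_prod; split.
- by rewrite -mulrA; exact: order_ge_lin (dilate_base_ab K).1 (dilate_base_ab K).2 hp.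
- by rewrite mulrC; exact: order_ge_lin (dilate_base_cd K).1 (dilate_base_cd K).2 hs.
- rewrite mulrAC mulrC.
  exact: order_ge_lin (dilate_base_diff K).1 (dilate_base_diff K).2 hr.
Qed.

Lemma bihom_vars : [/\ bihomog 1 0 Xa, bihomog 0 1 Xb, bihomog 1 0 Xc & bihomog 0 1 Xd].
Proof.
by split; [have := @bihomXm K U_(va) | have := @bihomXm K U_(vb)
  | have := @bihomXm K U_(vc) | have := @bihomXm K U_(vd)]; rewrite /bideg !mnm1E.
Qed.

Lemma lin_prod_bihom p1 p2 r1 r2 s1 s2 :
  bihomog (p1 + r1 + s1) (p2 + r2 + s2) (lin_prod p1 p2 r1 r2 s1 s2).
Proof.
have [ha hb hc hd] := bihom_vars.
have H := bihomM (bihomM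
  (bihomM (bihomX (n := p1) ha) (bihomX (n := p2) hb))
  (bihomM (bihomX (n := r1) (bihomB ha hc)) (bihomX (n := r2) (bihomB hb hd))))
  (bihomM (bihomX (n := s1) hc) (bihomX (n := s2) hd)).
by move: H; rewrite !mul1n !mul0n !addn0 !add0n.
Qed.

Lemma restr_lin_prod p1 p2 r1 r2 s1 s2 :
  restr (lin_prod p1 p2 r1 r2 s1 s2) = 'X^(p1 + p2) * ('X - 1) ^+ (r1 + r2).
Proof.
rewrite /lin_prod !rmorphM !rmorphXn !rmorphB /= !eval_rowsX /row_var.
by rewrite [_`_va]/= [_`_vb]/= [_`_vc]/= [_`_vd]/= !expr1n !mulr1 !exprD.
Qed.

(** The conditions along a = b = 0 and (a, b) = (c, d) force zeros of order d
    at 0 and at 1 on the restriction. *)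
Definition root_poly d : {poly K} := 'X^d * ('X - 1) ^+ d.

(** X^(d1+l) (X-1)^d1 is the restriction of any product of d1 + l forms of the
    first pair, d1 of the second and i + j - 2 d1 - l >= d2 of the third; the
    bidegree (i, j) is achieved by choosing i of them in the first column. *)
Lemma exists_lift d1 d2 i j l : (l < i + j + 1 - (2 * d1 + d2))%N ->
  exists2 f, piece (idealJ d1 d2) i j f &
    restr f = 'X^l * root_poly d1.
Proof.
move=> hl; pose s := (i + j - 2 * d1 - l)%N.
have [|p1 [r1 [s1 [hp hr hs hi hj]]]] := @distribute_factors (d1 + l) d1 s i j.
  by rewrite /s; lia.
exists (lin_prod p1 (d1 + l - p1) r1 (d1 - r1) s1 (s - s1)); last first.
  by rewrite restr_lin_prod !subnKC // exprD /root_poly mulrA [X in X * _]mulrC.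
split; last by rewrite -{1}hi -{1}hj; apply: lin_prod_bihom.
by apply: lin_prod_idealJ; rewrite subnKC // /s; lia.
Qed.

Lemma pieceD d1 d2 i j f g : piece (idealJ d1 d2) i j f ->
  piece (idealJ d1 d2) i j g -> piece (idealJ d1 d2) i j (f + g).
Proof.
move=> [/idealJP[h1 h2 h3] hf] [/idealJP[k1 k2 k3] hg]; split; last exact: bihomD.
apply/idealJP; split.
- exact: order_geD h1 k1.
- exact: order_geD h2 k2.
- exact: order_geD h3 k3.
Qed.

Lemma pieceZ d1 d2 i j c f : piece (idealJ d1 d2) i j f ->
  piece (idealJ d1 d2) i j (c *: f).
Proof.
move=> [/idealJP[h1 h2 h3] hf]; split; last exact: bihomZ.
apply/idealJP; split.
- exact: order_geZ h1.
- exact: order_geZ h2.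
- exact: order_geZ h3.
Qed.

Lemma mulDelta_inj : injective mulDelta.
Proof. exact: mulfI (Delta_neq0 K). Qed.

Lemma size_root_poly d : size (root_poly d) = (2 * d).+1.
Proof.
rewrite /root_poly mulrC size_monicM ?polyXn_neq0 //.
- by rewrite -polyC1 size_exp_XsubC size_polyXn; lia.
- by rewrite -polyC1 monic_exp // monicXsubC.
- by rewrite -size_poly_eq0 size_polyXn.
Qed.

Lemma root_poly_neq0 d : root_poly d != 0.
Proof. by rewrite -size_poly_eq0 size_root_poly. Qed.

Lemma restr_dvd d1 d2 f : idealJ d1 d2 f -> root_poly d1 %| restr f.
Proof.
move=> [h1 _ h3]; rewrite Gauss_dvdp ?restr_dvd_ab ?restr_dvd_diff //.
rewrite coprimep_expl // coprimep_expr //.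
by rewrite -polyC1 coprimep_XsubC rootX oner_eq0.
Qed.

(** V0 is the space of cofactors of Delta: the piece of J(d1-1, d2-1) of
    bidegree (i-1, j-1), or 0 if there is no such bidegree. *)
Lemma has_dim_piece_step d1 d2 i j (V0 : A -> Prop) k :
  (forall g, V0 g -> piece (idealJ d1 d2) i j (Delta * g)) ->
  (forall g, piece (idealJ d1 d2) i j (Delta * g) -> V0 g) ->
  has_dim V0 k ->
  has_dim (piece (@idealJ K d1 d2) i j) (i + j + 1 - (2 * d1 + d2) + k).
Proof.
move=> V0J JV0; set n := (i + j + 1 - (2 * d1 + d2))%N.
pose b (l : 'I_n) : {poly K} := 'X^l * root_poly d1.
have [u uV restr_u] := fin_all_exists2 (fun l : 'I_n => exists_lift (ltn_ord l)).
have bE (c : 'I_n -> K) :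
    \sum_l c l *: b l = (\sum_l c l *: 'X^l) * root_poly d1.
  by rewrite mulr_suml; apply: eq_bigr => l _; rewrite scalerAl.
apply: (has_dim_extension (mu := mulDelta) (phi := restr) (b := b) (u := u)).
- by move=> f g; apply: pieceD.
- by move=> c f; apply: pieceZ.
- exact: mulDelta_inj.
- by move=> g; apply: restr_Delta.
- exact: V0J.
- move=> f [Jf hf] f0; have [g hg] := restr_ker hf f0; exists g => //.
  by apply: JV0; rewrite -hg.
- exact: uV.
- exact: restr_u.
- move=> c; rewrite bE => /eqP; rewrite mulf_eq0 (negPf (root_poly_neq0 _)) orbF.
  move=> /eqP h0 l; have := congr1 (fun p : {poly K} => p`_l) h0.
  rewrite coef0 coef_sum (bigD1 l) //= coefZ coefXn eqxx mulr1 big1 ?addr0 //.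
  move=> l'; rewrite -val_eqE /= eq_sym => /negPf ne.
  by rewrite coefZ coefXn ne mulr0.
- move=> f [Jf hf]; have /dvdpP[R hR] := restr_dvd Jf.
  have sR : (size R <= n)%N.
    have [->|R0] := eqVneq R 0; first by rewrite size_poly0.
    have [_ Jcd _] := Jf; have := size_restr hf Jcd.
    rewrite hR size_mul ?root_poly_neq0 // size_root_poly /n.
    have : (0 < size R)%N by rewrite size_poly_gt0.
    by move: (size R) => sR; lia.
  exists (fun l => R`_l); rewrite bE; apply: (etrans hR); congr (_ * _).
  rewrite -(poly_def n (fun l => R`_l)); apply/polyP => l; rewrite coef_poly.
  by case: ltnP => // hl; rewrite nth_default // (leq_trans sR hl).
Qed.

Lemma has_dim_eq0 : has_dim (fun f : A => f = 0) 0.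
Proof.
exists (fun=> 0); split=> [[]//|c _ []//|f ->].
by exists (fun=> 0); rewrite big_ord0.
Qed.

Lemma Delta_piece0 d1 d2 i j f : (i == 0%N) || (j == 0%N) ->
  piece (idealJ d1 d2) i j (Delta * f) -> f = 0.
Proof.
move=> ij [_ hf]; apply/eqP; have := bicomp_Delta i j f.
by rewrite ij (bicomp_id hf) => /eqP; rewrite mulf_eq0 (negPf (Delta_neq0 K)).
Qed.

Lemma Delta_pieceS d1 d2 i j f :
  piece (idealJ d1 d2) i.+1 j.+1 (Delta * f) <-> piece (idealJ d1.-1 d2.-1) i j f.
Proof.
split=> -[Jf hf]; split.
- exact: (proj1 (idealJ_Delta _ _ _) Jf).
- have := bicomp_Delta i.+1 j.+1 f; rewrite (bicomp_id hf) /=.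
  by move/(mulfI (Delta_neq0 K)) => ->; apply: bihom_bicomp.
- exact: (proj2 (idealJ_Delta _ _ _) Jf).
- by have := bihomM (@bihom_Delta K) hf; rewrite !add1n.
Qed.

Lemma has_dim_piece d1 d2 i j :
  has_dim (piece (@idealJ K d1 d2) i j) (hilbJ d1 d2 i j).
Proof.
elim: i j d1 d2 => [|i IH] [|j] d1 d2; last first.
  apply: has_dim_piece_step (IH j d1.-1 d2.-1) => g.
    exact: (proj2 (Delta_pieceS _ _ _ _ _)).
  exact: (proj1 (Delta_pieceS _ _ _ _ _)).
all: apply: has_dim_piece_step has_dim_eq0 => g;
  [move=> ->; rewrite mulr0; split; [|exact: bihom0] | exact: Delta_piece0].
all: by split; apply: ideal_gen0.
Qed.

End Dimension.

Unset Implicit Arguments.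

Theorem theorem5p7 (R : realType) (d1 d2 : nat) (hd : (d1 <= d2)%N) :
  exists h : nat -> nat -> nat,
    is_hilbert_series (@idealJ R[i] d1 d2) h /\
    is_expansion (hilbert_fun d1 d2) (fun m n => (h m n)%:R).
Proof.
exists (hilbJ d1 d2); split; last exact: is_expansion_hilbJ.
by split; [exact: bigraded_idealJ|exact: has_dim_piece].
Qed.
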